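(* There exist an integral domain $D$ and a $\mathcal W$-operation $\star$ of $D$ which is not of finite type (and so $\star$ is not a complete $\mathcal W$-operation).
   Context: Let $D$ be an integral domain with quotient field $K$. $\overline{\boldsymbol F}(D)$ is the set of all nonzero $D$-submodules of $K$, and $\boldsymbol f(D)$ is the set of all nonzero finitely generated fractional ideals of $D$. A semistar operation of $D$ is a map $\star:\overline{\boldsymbol F}(D)\to\overline{\boldsymbol F}(D)$, $E\mapsto E^\star$, such that for all $0\ne z\in K$ and all $E,F\in\overline{\boldsymbol F}(D)$: $(zE)^\star=zE^\star$; $E\subseteq F$ implies $E^\star\subseteq F^\star$; $E\subseteq E^\star$ and $(E^\star)^\star=E^\star$. $\star$ is of finite type if $\star=\star_f$, where $E^{\star_f}=\bigcup\{F^\star: F\in\boldsymbol f(D),\ F\subseteq E\}$. For a family $\mathcal W$ of valuation overrings of $D$ (valuation domains between $D$ and $K$), $\wedge_{\mathcal W}$ is the semistar operation $E\mapsto\bigcap\{EW: W\in\mathcal W\}$. A $\mathcal W$-operation is a semistar operation equal to $\wedge_{\mathcal W}$ for some such family $\mathcal W$. A valuation overring $V$ of $D$ is a $\star$-valuation overring if $F^\star\subseteq FV$ for each $F\in\boldsymbol f(D)$; $b(\star)$ is the semistar operation $E\mapsto\bigcap\{EV: V\text{ a }\star\text{-valuation overring of }D\}$. A complete $\mathcal W$-operation is a semistar operation $\star$ such that $\star=b(\star)$ (equivalently, one of the form $b(\star')$ for some semistar operation $\star'$ on $D$). *)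

(* Defs.v *)
From HB Require Import structures.
From mathcomp Require Import all_boot all_algebra.
From mathcomp Require Import boolp classical_sets.

Set Implicit Arguments.
Unset Strict Implicit.
Unset Printing Implicit Defensive.

Import GRing.Theory.

Local Open Scope classical_set_scope.
Local Open Scope ring_scope.

Section Semistar.

Variable D : idomainType.
Local Notation K := {fraction D}.

Definition submodule (E : set K) : Prop :=
  [/\ E 0, (forall x y, E x -> E y -> E (x + y))
    & (forall (d : D) x, E x -> E (tofrac d * x))].

Definition Fbar : set (set K) :=
  [set E | submodule E /\ exists2 x, E x & x != 0].

Definition Dspan (s : seq K) : set K :=
  [set x | exists a : 'I_(size s) -> D, x = \sum_i tofrac (a i) * s`_i].

Definition fractional (E : set K) : Prop :=
  exists2 d : D, d != 0 & forall x, E x -> exists c : D, tofrac d * x = tofrac c.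

Definition fideal : set (set K) :=
  [set F | [/\ Fbar F, fractional F & exists s : seq K, F = Dspan s]].

Definition scale (z : K) (E : set K) : set K := [set z * x | x in E].

(* The product EW as the additive group generated by the products e * w. *)
Definition mulmod (E W : set K) : set K :=
  [set x | exists n (e w : 'I_n -> K),
     [/\ forall i, E (e i), forall i, W (w i) & x = \sum_i e i * w i]].

(* Operations on Fbar are represented by total maps on sets whose values      *)
(* outside Fbar are irrelevant; accordingly, operations are always compared   *)
(* on Fbar only.                                                              *)
Definition semistar (star : set K -> set K) : Prop :=
  [/\ forall E, Fbar E -> Fbar (star E),
      forall z E, z != 0 -> Fbar E -> star (scale z E) = scale z (star E),
      forall E F, Fbar E -> Fbar F -> E `<=` F -> star E `<=` star F
    & forall E, Fbar E -> E `<=` star E /\ star (star E) = star E].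

Definition star_eq (star1 star2 : set K -> set K) : Prop :=
  forall E, Fbar E -> star1 E = star2 E.

Definition star_f (star : set K -> set K) (E : set K) : set K :=
  \bigcup_(F in [set F | fideal F /\ F `<=` E]) star F.

Definition finite_type (star : set K -> set K) : Prop :=
  star_eq star (star_f star).

(* The fraction field K of D is also that of any ring between D and K, so a   *)
(* valuation domain V is recognised by: x or 1/x lies in V for all x != 0.    *)
(* K itself (the trivial valuation) is included.                              *)
Definition valuation_overring (V : set K) : Prop :=
  [/\ subring_closed [in V], forall d : D, V (tofrac d)
    & forall x, x != 0 -> V x \/ V x^-1].

Definition wedge (W : set (set K)) (E : set K) : set K :=
  \bigcap_(V in W) mulmod E V.

Definition W_operation (star : set K -> set K) : Prop :=
  semistar star /\
  exists2 W : set (set K), W `<=` valuation_overring & star_eq star (wedge W).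

Definition star_valuation_overring (star : set K -> set K) (V : set K) : Prop :=
  valuation_overring V /\ forall F, fideal F -> star F `<=` mulmod F V.

Definition b_op (star : set K -> set K) : set K -> set K :=
  wedge (star_valuation_overring star).

Definition complete_W_operation (star : set K -> set K) : Prop :=
  semistar star /\ star_eq star (b_op star).

End Semistar.

(* Main.v *)
Require Import Defs.
From mathcomp Require Import all_boot all_algebra.
From mathcomp Require Import boolp classical_sets.
From mathcomp Require Import filter.

Set Implicit Arguments.
Unset Strict Implicit.
Unset Printing Implicit Defensive.

Import GRing.Theory.

Local Open Scope classical_set_scope.
Local Open Scope ring_scope.

(** On D = Q[x, y] let v_n be the monomial valuation with v_n(x) = n and       *)
(* v_n(y) = 1, with ring V_n, and let star be the operation defined by all    *)
(* the V_n.  The module E of those e that eventually lie in the maximal ideal *)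
(* of V_n contains every x / y^i, which is a unit of V_i; hence 1 lies in     *)
(* E^star.  A finitely generated F inside E lies in the maximal ideal of V_n  *)
(* for a single large n, so 1 is not in F^star, and star is not of finite     *)
(* type.                                                                      *)
(*                                                                            *)
(* A complete operation star is of finite type: if z lies in no F^star with F *)
(* finitely generated inside E, pick for each F a star-valuation overring V_F *)
(* with z not in F V_F.  Their limit along an ultrafilter containing all the  *)
(* sets {F | e in F} is a star-valuation overring V with z not in EV.         *)

Lemma filter_forall_seq (T : Type) (I : eqType) (U : set_system T) (s : seq I)
    (P : I -> set T) : Filter U ->
  (forall i, i \in s -> U (P i)) ->
  U [set t | forall i, i \in s -> P i t].
Proof.
move=> FU; elim: s => [|i s IHs] Us; first by apply: filterS filterT.
have Ui : U (P i) by apply: Us; rewrite mem_head.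
have {}IHs : U [set t | forall j, j \in s -> P j t].
  by apply: IHs => j js; apply: Us; rewrite inE js orbT.
apply: filterS (filterI Ui IHs) => t [Pi Ps] j.
by rewrite inE => /orP[/eqP->|/Ps].
Qed.

Section FractionField.

Variable D : idomainType.
Local Notation K := {fraction D}.
Local Notation "d %:F" := (tofrac d).

Lemma fracP (x : K) : exists a b : D, b != 0 /\ x = a%:F / b%:F.
Proof.
elim/quotW: x => r; exists (frac r).1, (frac r).2; split; first exact: denom_ratioP.
have dr := denom_ratioP r.
apply: (mulIf (x := (frac r).2%:F)); first by rewrite tofrac_eq0.
rewrite divfK ?tofrac_eq0 //; unlock tofrac.
rewrite -[LHS]FracField.pi_mul /FracField.mulf /=.
apply/eqmodP; rewrite /= FracField.equivfE !numden_Ratio ?oner_eq0 ?mulr1 //.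
by rewrite mulrC.
Qed.

Lemma Dspan_submodule (s : seq K) : submodule (Dspan s).
Proof.
split.
- by exists (fun=> 0); rewrite big1 // => i _; rewrite tofrac0 mul0r.
- move=> _ _ [a ->] [b ->]; exists (fun i => a i + b i).
  by rewrite -big_split; apply: eq_bigr => i _; rewrite tofracD mulrDl.
- move=> d _ [a ->]; exists (fun i => d * a i).
  by rewrite mulr_sumr; apply: eq_bigr => i _; rewrite tofracM mulrA.
Qed.

Lemma Dspan_mem (s : seq K) x : x \in s -> Dspan s x.
Proof.
move=> xs; have sx : (index x s < size s)%N by rewrite index_mem.
exists (fun i => (i == Ordinal sx)%:R).
rewrite (bigD1 (Ordinal sx)) //= eqxx tofrac1 mul1r nth_index //.
by rewrite big1 ?addr0 // => i /negPf->; rewrite tofrac0 mul0r.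
Qed.

Lemma Dspan_min (s : seq K) (M : set K) :
  submodule M -> (forall x, x \in s -> M x) -> Dspan s `<=` M.
Proof.
move=> [M0 MD MZ] sM _ [a ->].
by apply: big_ind => // i _; apply/MZ/sM/mem_nth.
Qed.

Lemma seq_common_denominator (s : seq K) : exists2 d : D, d != 0 &
  forall x, x \in s -> exists c : D, d%:F * x = c%:F.
Proof.
elim: s => [|x s [d d0 ds]]; first by exists 1; rewrite ?oner_eq0.
have [a [b [b0 ->]]] := fracP x.
exists (b * d); first by rewrite mulf_neq0.
move=> y; rewrite inE => /orP[/eqP->|/ds[c dy]].
  exists (d * a).
  by rewrite !tofracM [b%:F * _]mulrC -mulrA [b%:F * _]mulrC divfK ?tofrac_eq0.
by exists (b * c); rewrite !tofracM -mulrA dy.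
Qed.

Lemma fideal_Dspan (s : seq K) x : x \in s -> x != 0 -> fideal (Dspan s).
Proof.
move=> xs x0; split; last by exists s.
- by split; [exact: Dspan_submodule|exists x => //; exact: Dspan_mem].
have [d d0 ds] := seq_common_denominator s; exists d => // y.
pose M := [set y : K | exists c : D, d%:F * y = c%:F].
suff : Dspan s `<=` M by apply.
apply: Dspan_min => //; split=> [|u v [a da] [b db]|c u [a da]].
- by exists 0; rewrite mulr0 tofrac0.
- by exists (a + b); rewrite mulrDr da db tofracD.
- by exists (c * a); rewrite mulrCA da tofracM.
Qed.

Lemma fideal_sub (E : set K) (t : seq K) :
  Fbar E -> (forall e, e \in t -> E e) ->
  exists F, [/\ fideal F, F `<=` E & forall e, e \in t -> F e].
Proof.
move=> [Esub [x Ex x0]] tE; exists (Dspan (x :: t)); split.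
- exact: fideal_Dspan (mem_head _ _) x0.
- by apply: Dspan_min => // e; rewrite inE => /orP[/eqP->|/tE].
- by move=> e et; apply: Dspan_mem; rewrite inE et orbT.
Qed.

Lemma mulmod_gen (E W : set K) e w : E e -> W w -> mulmod E W (e * w).
Proof.
by move=> Ee Ww; exists 1%N, (fun=> e), (fun=> w); rewrite big_ord1.
Qed.

Lemma mulmod0 (E W : set K) : mulmod E W 0.
Proof.
exists 0%N, (fun=> 0), (fun=> 0).
by split; [case|case|rewrite big_ord0].
Qed.

Lemma mulmodD (E W : set K) x y :
  mulmod E W x -> mulmod E W y -> mulmod E W (x + y).
Proof.
move=> [m [e [w [Ee Ww ->]]]] [n [e' [w' [Ee' Ww' ->]]]].
pose cat T (f : 'I_m -> T) (g : 'I_n -> T) i :=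
  match fintype.split i with inl j => f j | inr j => g j end.
exists (m + n)%N, (cat _ e e'), (cat _ w w'); split.
- by move=> i; rewrite /cat; case: (fintype.split i).
- by move=> i; rewrite /cat; case: (fintype.split i).
rewrite big_split_ord /cat; congr (_ + _); apply: eq_bigr => i _.
- by rewrite (unsplitK (inl i)).
- by rewrite (unsplitK (inr i)).
Qed.

Lemma mulmod_min (E W M : set K) :
  M 0 -> (forall x y, M x -> M y -> M (x + y)) ->
  (forall e w, E e -> W w -> M (e * w)) -> mulmod E W `<=` M.
Proof.
move=> M0 MD MM _ [n [e [w [Ee Ww ->]]]].
by apply: big_ind => // i _; apply: MM.
Qed.

Lemma mulmodS (E F W : set K) : E `<=` F -> mulmod E W `<=` mulmod F W.
Proof.
move=> EF; apply: mulmod_min; [exact: mulmod0|by move=> *; exact: mulmodD|].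
by move=> e w /EF; apply: mulmod_gen.
Qed.

Lemma mulmod_scale (E W : set K) z :
  z != 0 -> mulmod (scale z E) W = scale z (mulmod E W).
Proof.
move=> z0; apply/seteqP; split; last first.
  move=> _ [_ [n [e [w [Ee Ww ->]]]] <-]; exists n, (fun i => z * e i), w.
  split=> //; first by move=> i; exists (e i).
  by rewrite mulr_sumr; apply: eq_bigr => i _; rewrite mulrA.
apply: mulmod_min => [|x y [u Eu <-] [v Ev <-]|_ w [e Ee <-] Ww].
- by exists 0; [exact: mulmod0|rewrite mulr0].
- by exists (u + v); [exact: mulmodD|rewrite mulrDr].
- by exists (e * w); [exact: mulmod_gen|rewrite mulrA].
Qed.

Section ValuationOverring.

Variable V : set K.
Hypothesis Vval : valuation_overring V.

Lemma vring1 : V 1.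
Proof. by have [[/set_mem V1 _ _] _ _] := Vval. Qed.

Lemma vringB x y : V x -> V y -> V (x - y).
Proof.
have [[_ VB _] _ _] := Vval => Vx Vy.
by apply/set_mem/VB; apply/mem_set.
Qed.

Lemma vringM x y : V x -> V y -> V (x * y).
Proof.
have [[_ _ VM] _ _] := Vval => Vx Vy.
by apply/set_mem/VM; apply/mem_set.
Qed.

Lemma vring_frac (d : D) : V d%:F.
Proof. by have [] := Vval. Qed.

Lemma vring0 : V 0.
Proof. by rewrite -tofrac0; exact: vring_frac. Qed.

Lemma vringD x y : V x -> V y -> V (x + y).
Proof.
move=> Vx Vy; rewrite -[y]opprK; apply: vringB => //.
by rewrite -sub0r; apply: vringB => //; exact: vring0.
Qed.

Lemma vringV x : ~ V x -> V x^-1.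
Proof.
have [_ _ VV] := Vval; have [->|/VV[]//] := eqVneq x 0.
by move=> N0; have := N0 vring0.
Qed.

Lemma mulmodMr (E : set K) x v : mulmod E V x -> V v -> mulmod E V (x * v).
Proof.
move=> + Vv; move: x; apply: mulmod_min => [|x y Ex Ey|e w Ee Vw] /=.
- by rewrite mul0r; exact: mulmod0.
- by rewrite mulrDl; exact: mulmodD.
- by rewrite -mulrA; apply: mulmod_gen => //; exact: vringM.
Qed.

Lemma mulmod_submodule (E : set K) : submodule (mulmod E V).
Proof.
split; [exact: mulmod0|by move=> *; exact: mulmodD|].
by move=> d x Ex; rewrite mulrC; apply: mulmodMr => //; exact: vring_frac.
Qed.

Lemma sub_mulmod (E : set K) : E `<=` mulmod E V.
Proof. by move=> e Ee; rewrite -[e]mulr1; apply: mulmod_gen vring1. Qed.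

Lemma mulmod_idem (E : set K) : mulmod (mulmod E V) V `<=` mulmod E V.
Proof.
apply: mulmod_min; [exact: mulmod0|by move=> *; exact: mulmodD|].
by move=> *; exact: mulmodMr.
Qed.

End ValuationOverring.

Definition vmax (V : set K) : set K := [set u | u = 0 \/ ~ V u^-1].

Section MaximalIdeal.

Variable V : set K.
Hypothesis Vval : valuation_overring V.

Lemma vmaxN1 : ~ vmax V 1.
Proof.
case=> [/eqP|]; first by rewrite oner_eq0.
by rewrite invr1; apply; exact: vring1.
Qed.

Lemma vmaxM u v : vmax V u -> V v -> vmax V (u * v).
Proof.
have [->|v0] := eqVneq v 0; first by rewrite mulr0; left.
case=> [->|Vu Vv]; [by rewrite mul0r; left|right=> Vuv; apply: Vu].
by rewrite -[u](mulfK v0) invfM invrK; exact: vringM.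
Qed.

Lemma vmaxD u v : vmax V u -> vmax V v -> vmax V (u + v).
Proof.
have [->|u0] := eqVneq u 0; first by rewrite add0r.
have [->|v0] := eqVneq v 0; first by rewrite addr0.
move=> mu mv; have [Vuv|/(vringV Vval)] := EM (V (u / v)).
  have -> : u + v = v * (u / v + 1) by rewrite mulrDr mulrC divfK // mulr1.
  by apply: vmaxM => //; apply: vringD => //; exact: vring1.
rewrite invf_div => Vvu.
have -> : u + v = u * (1 + v / u) by rewrite mulrDr mulrCA divff // !mulr1.
by apply: vmaxM => //; apply: vringD => //; exact: vring1.
Qed.

Lemma vmax_submodule z : submodule [set e | vmax V (e / z)].
Proof.
split=> /= [|x y mx my|d x mx].
- by rewrite mul0r; left.
- by rewrite mulrDl; exact: vmaxD.
- by rewrite -mulrA mulrC; apply: vmaxM => //; exact: vring_frac.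
Qed.

(* In a valuation ring EV is the union of the principal fractional ideals eV, *)
(* so z lies outside of it exactly when every e is strictly smaller than z.   *)
Lemma notin_mulmod (E : set K) z :
  z != 0 -> ~ mulmod E V z <-> (forall e, E e -> vmax V (e / z)).
Proof.
move=> z0; split=> [EVz e Ee|Em EVz].
  apply: contrapT => /not_orP[/eqP ez /contrapT]; rewrite invf_div => Vze.
  apply: EVz; have -> : z = e * (z / e); last exact: mulmod_gen.
  by rewrite mulrC divfK //; apply: contra_neq ez => ->; rewrite mul0r.
suff /(_ z EVz) : mulmod E V `<=` [set e | vmax V (e / z)].
  by rewrite /= divff //; exact: vmaxN1.
have [m0 mD _] := vmax_submodule z.
apply: mulmod_min => // e w /Em me Vw /=.
by rewrite mulrAC; exact: vmaxM.
Qed.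

Lemma notin_mulmod_Dspan (s : seq K) z :
  z != 0 -> (forall e, e \in s -> vmax V (e / z)) -> ~ mulmod (Dspan s) V z.
Proof.
move=> z0 sm; apply/(notin_mulmod _ z0) => e.
suff : Dspan s `<=` [set e | vmax V (e / z)] by apply.
by apply: Dspan_min => //; exact: vmax_submodule.
Qed.

End MaximalIdeal.

Lemma wedge_semistar (W : set (set K)) :
  W `<=` @valuation_overring D -> semistar (wedge W).
Proof.
move=> Wval.
have sub_wedge E : E `<=` wedge W E.
  by move=> x Ex V /Wval Vval; exact: sub_mulmod.
split.
- move=> E [_ [x Ex x0]]; split; last by exists x => //; exact: sub_wedge.
  split=> [V _|x' y Ex' Ey V WV|d x' Ex' V WV]; first exact: mulmod0.
    by apply: mulmodD; [exact: Ex'|exact: Ey].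
  by have [_ _ MZ] := mulmod_submodule (Wval _ WV) E; apply/MZ/Ex'.
- move=> z E z0 _; apply/seteqP; split=> [x Ex|_ [x Ex <-] V WV].
    exists (x / z); last by rewrite mulrC divfK.
    move=> V WV; have := Ex V WV; rewrite mulmod_scale // => -[y Ey <-].
    by rewrite mulrC mulKf.
  by rewrite mulmod_scale //; exists x => //; exact: Ex.
- by move=> E F _ _ EF x Ex V WV; apply: mulmodS EF _ (Ex V WV).
- move=> E _; split; first exact: sub_wedge.
  apply/seteqP; split; last exact: sub_wedge.
  move=> x Ex V WV; apply: (mulmod_idem (Wval _ WV)).
  by apply: mulmodS (Ex V WV) => y Ey; exact: Ey.
Qed.

Section Ultralimit.

Variables (T : Type) (U : set_system T) (V : T -> set K).
Hypotheses (UU : UltraFilter U) (Vval : forall t, valuation_overring (V t)).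

Definition ultralim : set K := [set u | U [set t | V t u]].

Lemma ultralim_valuation_overring : valuation_overring ultralim.
Proof.
have UT (A : set T) : (forall t, A t) -> U A.
  by move=> At; apply: filterS filterT.
split=> [|d|x x0].
- split=> [|x y /set_mem Vx /set_mem Vy|x y /set_mem Vx /set_mem Vy];
    apply/mem_set.
  + by apply: UT => t; exact: vring1.
  + by apply: filterS (filterI Vx Vy) => t [] /=; exact: vringB.
  + by apply: filterS (filterI Vx Vy) => t [] /=; exact: vringM.
- by apply: UT => t; exact: vring_frac.
- have [|NVx] := in_ultra_setVsetC [set t | V t x] UU; [by left|right].
  by apply: filterS NVx => t /=; exact: vringV.
Qed.

Lemma vmax_ultralim u : vmax ultralim u <-> U [set t | vmax (V t) u].
Proof.
have [->|u0] := eqVneq u 0.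
  by split=> _; [apply: filterS filterT => t _|]; left.
split=> [[/eqP|NVu]|Um]; first by rewrite (negPf u0).
  have [//|] := in_ultra_setVsetC [set t | V t u^-1] UU.
  by apply: filterS => t /=; right.
right=> UVu.
have /filter_ex[t [[/eqP|]]] //:
  U ([set t | vmax (V t) u] `&` [set t | V t u^-1]) by exact: filterI.
by rewrite (negPf u0).
Qed.

End Ultralimit.

Lemma star_valuation_ultralim (T : Type) (U : set_system T) (V : T -> set K)
    (star : set K -> set K) :
  UltraFilter U -> (forall t, star_valuation_overring star (V t)) ->
  star_valuation_overring star (ultralim U V).
Proof.
move=> UU Vstar; have Vval t : valuation_overring (V t) by have [] := Vstar t.
have Uval := ultralim_valuation_overring UU Vval.
split=> // G Gf y Gy.
have [_ _ [s Gs]] := Gf.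
have [->|y0] := eqVneq y 0; first exact: mulmod0.
apply: contrapT => /(notin_mulmod Uval _ y0) Gm.
have /filter_ex[t tm] : U [set t | forall e, e \in s -> vmax (V t) (e / y)].
  apply: filter_forall_seq => e es.
  by apply/vmax_ultralim => //; apply: Gm; rewrite Gs; exact: Dspan_mem.
apply: (notin_mulmod_Dspan (Vval t) y0 tm); rewrite -Gs.
by have [_ /(_ G Gf y Gy)] := Vstar t.
Qed.

Theorem complete_W_operation_finite_type (star : set K -> set K) :
  complete_W_operation star -> finite_type star.
Proof.
move=> [[starF _ starS _] starb] E EF.
apply/seteqP; split=> [z Ez|z [F [[FF _ _] FE] Fz]]; last first.
  exact: starS FE _ Fz.
apply: contrapT => Nz.
have z0 : z != 0.
  apply: contra_notN Nz => /eqP ->.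
  have [//|F [Ff FE _]] := @fideal_sub E [::] EF.
  have [FF _ _] := Ff; exists F => //.
  by have [[]] := starF F FF.
pose T := {F : set K | fideal F /\ F `<=` E}.
have /choice[V Vz] (F : T) : exists V,
    star_valuation_overring star V /\ ~ mulmod (sval F) V z.
  case: F => F [Ff FE] /=; have [FF _ _] := Ff.
  apply: contrapT => NV; apply: Nz; exists F => //.
  rewrite starb // => V Vstar; apply: contrapT => FVz.
  by apply: NV; exists V.
pose B (t : seq K) := [set F : T | forall e, e \in t -> sval F e].
have FB : ProperFilter (filter_from [set t | forall e, e \in t -> E e] B).
  apply: filter_from_proper; last first.
    move=> t tE; have [F [Ff FE tF]] := fideal_sub EF tE.
    by exists (exist _ F (conj Ff FE)).
  apply: filter_from_filter; first by exists [::].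
  move=> s t sE tE; exists (s ++ t).
    by move=> e; rewrite mem_cat => /orP[/sE|/tE].
  by move=> F stF; split=> e et; apply: stF; rewrite mem_cat et ?orbT.
have [U [UU BU]] := ultraFilterLemma FB.
have Vstar F := (Vz F).1.
have Vval F : valuation_overring (V F) by have [] := Vstar F.
have Ustar := star_valuation_ultralim UU Vstar.
have : mulmod E (ultralim U V) z by move: Ez; rewrite starb //; apply.
apply/(notin_mulmod (ultralim_valuation_overring UU Vval) _ z0) => e Ee.
apply/vmax_ultralim => //; apply: BU; exists [:: e].
  by move=> e'; rewrite inE => /eqP->.
move=> F /(_ e (mem_head _ _)) Fe /=.
by apply: (notin_mulmod (Vval F) _ z0).1 Fe; exact: (Vz F).2.
Qed.

Theorem wedge_not_finite_type (V : nat -> set K) :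
  (forall n, valuation_overring (V n)) ->
  (forall n, exists e, [/\ e != 0, V n e^-1 & \forall m \near \oo, vmax (V m) e]) ->
  ~ finite_type (wedge (range V)).
Proof.
move=> Vval Ve.
pose E := [set e : K | \forall m \near \oo, vmax (V m) e].
have EF : Fbar E.
  split; last by have [e [e0 _ Ee]] := Ve 0%N; exists e.
  split=> [|x y Ex Ey|d x Ex].
  - by apply: filterS filterT => m _; left.
  - by apply: filterS (filterI Ex Ey) => m [] /=; exact: vmaxD.
  - apply: filterS Ex => m xm; rewrite mulrC; apply: vmaxM => //.
    exact: vring_frac.
move=> /(_ E EF) Efin.
have : wedge (range V) E 1.
  move=> _ [n _ <-]; have [e [e0 Ve1 Ee]] := Ve n.
  by rewrite -(divff e0); exact: mulmod_gen.
rewrite Efin => -[F [[_ _ [s Fs]] FE] F1].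
have /filter_ex[n sn] : \forall m \near \oo, forall e, e \in s -> vmax (V m) e.
  by apply: filter_forall_seq => e es; apply: FE; rewrite Fs; exact: Dspan_mem.
have /(_ (V n)) := F1; rewrite Fs => /(_ (ex_intro2 _ _ n I erefl)).
apply: notin_mulmod_Dspan; rewrite ?oner_eq0 // => e es.
by rewrite divr1; exact: sn.
Qed.

Section NatValuation.

Variable w : D -> nat.
Hypothesis wM : forall a b, a != 0 -> b != 0 -> w (a * b) = (w a + w b)%N.
Hypothesis wD : forall n a b, a != 0 -> b != 0 -> a + b != 0 ->
  (n <= w a)%N -> (n <= w b)%N -> (n <= w (a + b))%N.

Definition valring : set K :=
  [set u | exists a b : D,
     [/\ b != 0, u = a%:F / b%:F & a != 0 -> (w b <= w a)%N]].

Lemma valring_frac a b :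
  a != 0 -> b != 0 -> valring (a%:F / b%:F) <-> (w b <= w a)%N.
Proof.
move=> a0 b0; split=> [[c [d [d0 cd wcd]]]|]; last by exists a, b.
have /eqP : a * d = c * b.
  apply/eqP; rewrite -tofrac_eq !tofracM; apply/eqP.
  apply: (mulIf (x := (b%:F * d%:F)^-1)).
    by rewrite invr_eq0 mulf_neq0 ?tofrac_eq0.
  by rewrite -mulf_div divff ?tofrac_eq0 // mulr1 [b%:F * _]mulrC -mulf_div
             divff ?tofrac_eq0 // mulr1.
have [->|c0] := eqVneq c 0; first by rewrite mul0r mulf_eq0 (negPf a0) (negPf d0).
move=> /eqP /(congr1 w); rewrite !wM // => wE.
by rewrite -(leq_add2r (w d)) wE addnC leq_add2r wcd.
Qed.

Lemma natval1 : w 1 = 0%N.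
Proof.
by apply/eqP; rewrite -(eqn_add2r (w 1)) -wM ?oner_eq0 // mulr1.
Qed.

Lemma natvalN a : a != 0 -> w (- a) = w a.
Proof.
move=> a0; have N0 : (-1 : D) != 0 by rewrite oppr_eq0 oner_eq0.
rewrite -mulN1r wM //; suff -> : w (-1) = 0%N by [].
apply/eqP; have /eqP := wM N0 N0.
by rewrite mulN1r opprK natval1 eq_sym addn_eq0 andbb.
Qed.

Lemma valring_valuation_overring : valuation_overring valring.
Proof.
have valB x y : valring x -> valring y -> valring (x - y).
  move=> [a [b [b0 -> wab]]] [c [d [d0 -> wcd]]].
  exists (a * d - c * b), (b * d); split; first by rewrite mulf_neq0.
    rewrite tofracB !tofracM mulrBl -mulf_div divff ?tofrac_eq0 // mulr1.
    by rewrite [b%:F * _]mulrC -mulf_div divff ?tofrac_eq0 // mulr1.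
  have [->|a0] := eqVneq a 0.
    rewrite mul0r sub0r oppr_eq0 => cb0; rewrite natvalN //.
    move: cb0; rewrite mulf_eq0 negb_or => /andP[c0 _].
    by rewrite !wM // addnC leq_add2r wcd.
  have [->|c0] := eqVneq c 0.
    by rewrite mul0r subr0 => _; rewrite !wM // leq_add2r wab.
  move=> N0; apply: wD => //; rewrite ?oppr_eq0 ?mulf_neq0 //.
    by rewrite !wM // leq_add2r wab.
  by rewrite natvalN ?mulf_neq0 // !wM // addnC leq_add2r wcd.
split=> [|d|x].
- split=> [|x y /set_mem Vx /set_mem Vy|x y /set_mem Vx /set_mem Vy];
    apply/mem_set; last 1 first.
  + have [[a [b [b0 -> wab]]] [c [d [d0 -> wcd]]]] := (Vx, Vy).
    exists (a * c), (b * d).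
    split; [by rewrite mulf_neq0|by rewrite mulf_div -!tofracM|].
    rewrite mulf_eq0 negb_or => /andP[a0 c0].
    by rewrite !wM // leq_add ?wab ?wcd.
  + by exists 1, 1; split; rewrite ?oner_eq0 ?tofrac1 ?divr1.
  + exact: valB.
- by exists d, 1; split; rewrite ?oner_eq0 ?tofrac1 ?divr1 ?natval1.
- have [a [b [b0 ->]]] := fracP x => ab0.
  have a0 : a != 0 by apply: contra_neq ab0 => ->; rewrite tofrac0 mul0r.
  rewrite invf_div; have /orP[ba|ab] := leq_total (w b) (w a).
    by left; apply/valring_frac.
  by right; apply/valring_frac.
Qed.

Lemma vmax_valring_frac a b :
  a != 0 -> b != 0 -> vmax valring (a%:F / b%:F) <-> (w b < w a)%N.
Proof.
move=> a0 b0; split=> [[/eqP|]|ab].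
- by rewrite mulf_eq0 invr_eq0 !tofrac_eq0 (negPf a0) (negPf b0).
- rewrite invf_div ltnNge => NV; apply/negP => ab; apply: NV.
  exact/(valring_frac b0 a0).
- by right; rewrite invf_div => /(valring_frac b0 a0); rewrite leqNgt ab.
Qed.

End NatValuation.

End FractionField.

Section MonomialValuation.

Local Notation D := {poly {poly rat}}.
Local Notation L := {fraction {poly rat}}.

(* As elements of Q[y][x] with 'X = x and 'X%:P = y, this substitutes x y^n   *)
(* for x and makes y the main variable.                                       *)
Definition blowup (n : nat) (f : D) : {poly L} :=
  map_poly (@tofrac _) (swapXY (f \Po ('X^n *: 'X))).

Lemma blowupM n f g : blowup n (f * g) = blowup n f * blowup n g.
Proof. by rewrite /blowup comp_polyM !rmorphM. Qed.

Lemma blowupD n f g : blowup n (f + g) = blowup n f + blowup n g.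
Proof. by rewrite /blowup comp_polyD !rmorphD. Qed.

Lemma blowup_eq0 n f : (blowup n f == 0) = (f == 0).
Proof.
rewrite /blowup -(rmorph0 (map_poly (@tofrac {poly rat}))).
rewrite (inj_eq (map_inj_poly _ (tofrac0 _))); last first.
  by move=> a b /eqP; rewrite tofrac_eq => /eqP.
rewrite swapXY_eq0 comp_poly_eq0 // size_scale ?size_polyX //.
by rewrite expf_neq0 ?polyX_eq0.
Qed.

Definition monomial_val n (f : D) : nat := mup 0 (blowup n f).

Lemma monomial_valM n f g : f != 0 -> g != 0 ->
  monomial_val n (f * g) = (monomial_val n f + monomial_val n g)%N.
Proof. by move=> f0 g0; rewrite /monomial_val blowupM mupM ?blowup_eq0. Qed.

Lemma monomial_valD n m f g : f != 0 -> g != 0 -> f + g != 0 ->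
  (m <= monomial_val n f)%N -> (m <= monomial_val n g)%N ->
  (m <= monomial_val n (f + g))%N.
Proof.
move=> f0 g0 fg0; rewrite /monomial_val !mup_geq ?blowup_eq0 // blowupD.
exact: dvdp_add.
Qed.

Lemma mup0X n : mup (0 : L) 'X^n = n.
Proof. by have := mup_XsubCX n (0 : L) 0; rewrite polyC0 subr0 eqxx. Qed.

Lemma monomial_valx n : monomial_val n 'X = n.
Proof.
rewrite /monomial_val /blowup comp_polyX -mul_polyC rmorphM /= swapXY_polyC.
rewrite swapXY_X rmorphM /= map_polyXn map_polyXn map_polyC /= mupMl ?mup0X //.
by rewrite rootC tofrac_eq0 polyX_eq0.
Qed.

Lemma monomial_valy n i : monomial_val n ('X%:P ^+ i) = i.
Proof.
rewrite /monomial_val /blowup -polyC_exp comp_polyC swapXY_polyC.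
by rewrite !map_polyXn mup0X.
Qed.

End MonomialValuation.

Theorem mainTheorem6 :
  exists (D : idomainType) (star : set {fraction D} -> set {fraction D}),
    [/\ W_operation star, ~ finite_type star & ~ complete_W_operation star].
Proof.
pose V n := valring (monomial_val n).
have Vval n : valuation_overring (V n).
  apply: valring_valuation_overring; [exact: monomial_valM|exact: monomial_valD].
have Wval : range V `<=` @valuation_overring _ by move=> _ [n _ <-].
have Nfin : ~ finite_type (wedge (range V)).
  have x0 : 'X != 0 :> {poly {poly rat}} by rewrite polyX_eq0.
  have y0 n : 'X%:P ^+ n != 0 :> {poly {poly rat}}.
    by rewrite expf_neq0 // polyC_eq0 polyX_eq0.
  apply: wedge_not_finite_type => // n.
  exists (tofrac 'X / tofrac ('X%:P ^+ n)); split.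
  - by rewrite mulf_neq0 ?invr_eq0 ?tofrac_eq0.
  - rewrite invf_div; apply/valring_frac => //; first exact: monomial_valM.
    by rewrite monomial_valx monomial_valy.
  - exists n.+1 => // m /= nm; apply/vmax_valring_frac => //.
      exact: monomial_valM.
    by rewrite monomial_valx monomial_valy.
exists {poly {poly rat}}, (wedge (range V)); split=> //.
- by split; [exact: wedge_semistar|exists (range V)].
- by move=> /complete_W_operation_finite_type.
Qed.
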